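(* Let $A\in\mathbb{R}^{n\times n}$ be symmetric and positive definite, let $b,x_0\in\mathbb{R}^{n\times m}$, $r_0=b-Ax_0$, and let $k\ge1$ be such that $\dim\mathcal{K}_{k+1}(A,r_0)=(k+1)m$. Consider the quantities determined by the Dubrulle-P block CG algorithm (DP-BCG) applied to $A,b,x_0$, and let $\sigma_0=\psi_0$, $\beta_1=\sigma_0$, $\theta_0=I$, and $\ell_0=0$. Then, for $j=1,\dots,k$, the block Lanczos coefficients $\alpha_j$ and $\beta_{j+1}$ (of the block Lanczos algorithm started with $A$ and $v=r_0$) forming the matrix $T_k$, and the coefficients $\ell_j$ and $d_j$ used in $T_k=L_kD_kL_k^T$, where $L_k$ is block lower bidiagonal with identity diagonal blocks and subdiagonal blocks $\ell_1,\dots,\ell_{k-1}$, and $D_k=\mathrm{diag}(d_1,\dots,d_k)$ is block diagonal, can be computed using the recurrences \[ \begin{aligned} \tau_j&=\gamma_{j-1}^{-1}\psi_{j-1}\sigma_{j-1}^{-1}\theta_{j-1},\\ d_j&=\theta_{j-1}^T\sigma_{j-1}\tau_j,\\ \alpha_j&=d_j+\ell_{j-1}\beta_j^T,\\ \sigma_j&=\mathtt{chol}(\psi_j^Tp_j^Tr_j),\\ [\theta_j,\beta_{j+1}]&=\mathtt{qr}(\sigma_j\tau_j),\\ \ell_j&=\theta_j^T\sigma_j\sigma_{j-1}^{-1}\theta_{j-1}. \end{aligned} \] The Lanczos block $v_{k+1}$ can be reconstructed using $v_{k+1}=(-1)^kr_k\sigma_k^{-1}\theta_k^{-T}$.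
   Context: All computations are in exact arithmetic. $I$ denotes the $m\times m$ identity matrix. For $v\in\mathbb{R}^{n\times m}$, $\mathcal{K}_k(A,v)=\mathrm{colspan}\{v,Av,\dots,A^{k-1}v\}$ is the span of all columns of the blocks $v,Av,\dots,A^{k-1}v$. Notation: $[Q,R]=\mathtt{qr}(B)$ means that $B=QR$ is the QR factorization of a full column rank matrix $B$ with $m$ columns, where $Q$ has orthonormal columns and has the same size as $B$, and $R$ is $m\times m$ upper triangular with positive diagonal entries. For a symmetric positive definite $G$, $\mathtt{chol}(G)$ is the upper triangular matrix $R$ with positive diagonal such that $R^TR=G$. Block Lanczos algorithm (input: symmetric $A$, $v\in\mathbb{R}^{n\times m}$): $v_0=0$; $[v_1,\beta_1]=\mathtt{qr}(v)$; for $k=1,2,\dots$: $w=Av_k-v_{k-1}\beta_k^T$; $\alpha_k=v_k^Tw$; $w\leftarrow w-v_k\alpha_k$; $[v_{k+1},\beta_{k+1}]=\mathtt{qr}(w)$. The matrix $T_k\in\mathbb{R}^{km\times km}$ is the symmetric block tridiagonal matrix with diagonal blocks $\alpha_1,\dots,\alpha_k$, subdiagonal blocks $\beta_2,\dots,\beta_k$ and superdiagonal blocks $\beta_2^T,\dots,\beta_k^T$. Dubrulle-P block CG algorithm (DP-BCG) (input: symmetric positive definite $A$, $b\in\mathbb{R}^{n\times m}$, $x_0\in\mathbb{R}^{n\times m}$): $r_0=b-Ax_0$; $[p_0,\psi_0]=\mathtt{qr}(r_0)$; for $k=1,2,\dots$: $\gamma_{k-1}=(p_{k-1}^TAp_{k-1})^{-1}p_{k-1}^Tr_{k-1}$;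 $x_k=x_{k-1}+p_{k-1}\gamma_{k-1}$; $r_k=r_{k-1}-Ap_{k-1}\gamma_{k-1}$; $\delta_k=-(p_{k-1}^TAp_{k-1})^{-1}p_{k-1}^TAr_k$; $[p_k,\psi_k]=\mathtt{qr}(r_k+p_{k-1}\delta_k)$. The coefficients with index $k$ are understood as belonging to the next matrices ($\beta_{k+1}$ to $T_{k+1}$, $\ell_k$ to $L_{k+1}$). *)

(* Defs.v *)
From mathcomp Require Import all_boot all_order all_algebra.
From mathcomp Require Import boolp classical_sets reals.

Set Implicit Arguments.
Unset Strict Implicit.
Unset Printing Implicit Defensive.

Import Order.TTheory GRing.Theory Num.Theory.
Local Open Scope ring_scope.

Definition spdmx (R : realType) (n : nat) (A : 'M[R]_n) : Prop :=
  A^T = A /\ forall x : 'cV[R]_n, x != 0 -> 0 < (x^T *m A *m x) 0 0.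

(* Subspaces are row spaces in mxalgebra: the row space of [krylov A v k] is
   K_k(A, v) with its vectors transposed, and its dimension is the rank. *)
Definition krylov (R : realType) (n m : nat) (A : 'M[R]_n) (v : 'M[R]_(n, m))
    (k : nat) : 'M[R]_n :=
  (\sum_(i < k) <<((A ^+ i) *m v)^T>>)%MS.

(* [is_trig_mx] means lower triangular. *)
Definition upper_posdiag (R : realType) (m : nat) (U : 'M[R]_m) : Prop :=
  is_trig_mx U^T /\ forall i, 0 < U i i.

Definition is_qr (R : realType) (n m : nat) (B : 'M[R]_(n, m))
    (QU : 'M[R]_(n, m) * 'M[R]_m) : Prop :=
  [/\ B = QU.1 *m QU.2, QU.1^T *m QU.1 = 1%:M & upper_posdiag QU.2].

Definition is_chol (R : realType) (m : nat) (G U : 'M[R]_m) : Prop :=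
  U^T *m U = G /\ upper_posdiag U.

(* Total versions of the factorizations: the value is 0 when none exists, i.e.
   when B is not of full column rank, resp. when G is not symmetric positive
   definite. *)
Definition qr (R : realType) (n m : nat) (B : 'M[R]_(n, m)) :
    'M[R]_(n, m) * 'M[R]_m :=
  xget (0, 0) [set QU | is_qr B QU]%classic.

Definition chol (R : realType) (m : nat) (G : 'M[R]_m) : 'M[R]_m :=
  xget 0 [set U | is_chol G U]%classic.

(* [BLState v_(k-1) v_k beta_k], available at the start of step k >= 1. *)
Record bl_state (R : realType) (n m : nat) := BLState {
  bl_vprev : 'M[R]_(n, m);
  bl_v : 'M[R]_(n, m);
  bl_beta : 'M[R]_m }.

Definition bl_w (R : realType) (n m : nat) (A : 'M[R]_n) (s : bl_state R n m) :
    'M[R]_(n, m) :=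
  A *m bl_v s - bl_vprev s *m (bl_beta s)^T.

Definition bl_alpha (R : realType) (n m : nat) (A : 'M[R]_n)
    (s : bl_state R n m) : 'M[R]_m :=
  (bl_v s)^T *m bl_w A s.

Definition bl_resid (R : realType) (n m : nat) (A : 'M[R]_n)
    (s : bl_state R n m) : 'M[R]_(n, m) :=
  bl_w A s - bl_v s *m bl_alpha A s.

Definition bl_step (R : realType) (n m : nat) (A : 'M[R]_n)
    (s : bl_state R n m) : bl_state R n m :=
  let: (v', beta') := qr (bl_resid A s) in BLState (bl_v s) v' beta'.

Definition bl_init (R : realType) (n m : nat) (v : 'M[R]_(n, m)) :
    bl_state R n m :=
  let: (v1, beta1) := qr v in BLState 0 v1 beta1.

(* State at the start of step k; meaningful for k >= 1 only (at k = 0 it is the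
   same as at k = 1), like the coefficients [lanczos_alpha] and [lanczos_beta],
   whose indexing starts at 1. *)
Definition lanczos (R : realType) (n m : nat) (A : 'M[R]_n) (v : 'M[R]_(n, m))
    (k : nat) : bl_state R n m :=
  iter k.-1 (bl_step A) (bl_init v).

Definition lanczos_v (R : realType) (n m : nat) (A : 'M[R]_n)
    (v : 'M[R]_(n, m)) (k : nat) : 'M[R]_(n, m) :=
  if k is 0 then 0 else bl_v (lanczos A v k).

Definition lanczos_alpha (R : realType) (n m : nat) (A : 'M[R]_n)
    (v : 'M[R]_(n, m)) (k : nat) : 'M[R]_m :=
  bl_alpha A (lanczos A v k).

Definition lanczos_beta (R : realType) (n m : nat) (A : 'M[R]_n)
    (v : 'M[R]_(n, m)) (k : nat) : 'M[R]_m :=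
  bl_beta (lanczos A v k).

(* All matrices passed to [qr] up to and including step k are of full column
   rank, so that v_1, ..., v_(k+1) are well defined. *)
Definition lanczos_runs (R : realType) (n m : nat) (A : 'M[R]_n)
    (v : 'M[R]_(n, m)) (k : nat) : Prop :=
  row_full v /\
  forall j, (1 <= j <= k)%N -> row_full (bl_resid A (lanczos A v j)).

Record dp_state (R : realType) (n m : nat) := DPState {
  dp_x : 'M[R]_(n, m);
  dp_r : 'M[R]_(n, m);
  dp_p : 'M[R]_(n, m);
  dp_psi : 'M[R]_m }.

Definition dp_pAp (R : realType) (n m : nat) (A : 'M[R]_n)
    (s : dp_state R n m) : 'M[R]_m :=
  (dp_p s)^T *m A *m dp_p s.

Definition dp_gamma (R : realType) (n m : nat) (A : 'M[R]_n)
    (s : dp_state R n m) : 'M[R]_m :=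
  invmx (dp_pAp A s) *m ((dp_p s)^T *m dp_r s).

Definition dp_rnext (R : realType) (n m : nat) (A : 'M[R]_n)
    (s : dp_state R n m) : 'M[R]_(n, m) :=
  dp_r s - A *m dp_p s *m dp_gamma A s.

Definition dp_delta (R : realType) (n m : nat) (A : 'M[R]_n)
    (s : dp_state R n m) : 'M[R]_m :=
  - (invmx (dp_pAp A s) *m ((dp_p s)^T *m A *m dp_rnext A s)).

(* The matrix r_k + p_(k-1) delta_k, from the state of index k-1. *)
Definition dp_dir (R : realType) (n m : nat) (A : 'M[R]_n)
    (s : dp_state R n m) : 'M[R]_(n, m) :=
  dp_rnext A s + dp_p s *m dp_delta A s.

Definition dp_step (R : realType) (n m : nat) (A : 'M[R]_n)
    (s : dp_state R n m) : dp_state R n m :=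
  let: (p', psi') := qr (dp_dir A s) in
  DPState (dp_x s + dp_p s *m dp_gamma A s) (dp_rnext A s) p' psi'.

Definition dp_init (R : realType) (n m : nat) (A : 'M[R]_n)
    (b x0 : 'M[R]_(n, m)) : dp_state R n m :=
  let: (p0, psi0) := qr (b - A *m x0) in DPState x0 (b - A *m x0) p0 psi0.

(* (x_k, r_k, p_k, psi_k) *)
Definition dpbcg (R : realType) (n m : nat) (A : 'M[R]_n)
    (b x0 : 'M[R]_(n, m)) (k : nat) : dp_state R n m :=
  iter k (dp_step A) (dp_init A b x0).

(* No inverse and no QR factorization up to and including step k is undefined. *)
Definition dpbcg_runs (R : realType) (n m : nat) (A : 'M[R]_n)
    (b x0 : 'M[R]_(n, m)) (k : nat) : Prop :=
  row_full (b - A *m x0) /\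
  forall j, (j < k)%N ->
    dp_pAp A (dpbcg A b x0 j) \in unitmx /\
    row_full (dp_dir A (dpbcg A b x0 j)).

(* Block sequences keep their usual 1-based indices, whereas block positions
   i, j : 'I_k start at 0. *)
Definition block_tridiag (R : realType) (m k : nat)
    (alpha beta : nat -> 'M[R]_m) : 'M[R]_(\sum_(i < k) m)%N :=
  \mxblock_(i < k, j < k)
    (if i == j :> nat then alpha i.+1
     else if i == j.+1 :> nat then beta i.+1
     else if j == i.+1 :> nat then (beta j.+1)^T
     else 0).

Definition block_unit_bidiag (R : realType) (m k : nat)
    (ell : nat -> 'M[R]_m) : 'M[R]_(\sum_(i < k) m)%N :=
  \mxblock_(i < k, j < k)
    (if i == j :> nat then 1%:M
     else if i == j.+1 :> nat then ell j.+1
     else 0).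

Definition block_diag (R : realType) (m k : nat)
    (d : nat -> 'M[R]_m) : 'M[R]_(\sum_(i < k) m)%N :=
  \mxdiag_(i < k) d i.+1.

Definition is_block_ldl (R : realType) (m k : nat)
    (T : 'M[R]_(\sum_(i < k) m)%N) (ell d : nat -> 'M[R]_m) : Prop :=
  T = block_unit_bidiag k ell *m block_diag k d *m (block_unit_bidiag k ell)^T.

(* Main.v *)
(* In DP-BCG, r_j^T r_(j+1) = 0 and psi_j^T p_j^T r_j = r_j^T r_j, so that
   sigma_j is the R factor of r_j and v_(j+1) := (-1)^j r_j sigma_j^-1 theta_j has
   orthonormal columns.  Put u_j := (-1)^j p_j psi_j sigma_j^-1 theta_j.
   Eliminating p_j and gamma_j from the CG recurrences gives
     A u_j = v_(j+1) d_(j+1) + v_(j+2) beta_(j+2),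
     v_(j+2) = u_(j+1) + u_j ell_(j+1)^T,
   that is, A U = V L D up to the last block column, and V = U L^T.  Eliminating
   u_j yields the three-term recurrence of block Lanczos with T = L D L^T, and
   the uniqueness of the QR factorization identifies the v_j with the Lanczos
   blocks.  Since K_(j+2) is contained in the sum of K_(j+1) and the column
   space of r_(j+1), the rank hypothesis forces all r_j to be of full column
   rank. *)

Require Import Defs.
From mathcomp Require Import all_boot all_order all_algebra.
From mathcomp Require Import ring.
From mathcomp Require Import classical_sets reals.

Set Implicit Arguments.
Unset Strict Implicit.
Unset Printing Implicit Defensive.

Import Order.TTheory GRing.Theory Num.Theory.
Local Open Scope ring_scope.

(** * Cholesky and QR factorizations *)

Lemma spdmx_unit (R : realType) (n : nat) (G : 'M[R]_n) :
  spdmx G -> G \in unitmx.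
Proof.
move=> [symG posG]; rewrite -row_free_unit -kermx_eq0; apply: contraT.
case/rowV0Pn=> v /sub_kermxP vG v0.
by have := posG v^T; rewrite trmxK vG mul0mx mxE ltxx trmx_eq0 => /(_ v0).
Qed.

Lemma spdmx1 (R : realType) (n : nat) : spdmx (1%:M : 'M[R]_n).
Proof.
split=> [|x x0]; first exact: trmx1.
rewrite mulmx1 mxE; under eq_bigr do rewrite mxE -expr2.
rewrite lt_def sumr_ge0 ?andbT => [|i _]; last exact: sqr_ge0.
apply: contra x0 => /eqP/psumr_eq0P z0; apply/eqP/colP=> i; rewrite mxE.
by apply/eqP; rewrite -sqrf_eq0 z0 // => j _; exact: sqr_ge0.
Qed.

Lemma spdmx_congr (R : realType) (n m : nat) (A : 'M[R]_n)
    (B : 'M[R]_(n, m)) :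
  spdmx A -> row_full B -> spdmx (B^T *m A *m B).
Proof.
move=> [symA posA] /row_fullP[C CB]; split=> [|x x0].
  by rewrite !trmx_mul symA trmxK mulmxA.
suff Bx0 : B *m x != 0.
  by have := posA _ Bx0; rewrite trmx_mul !mulmxA.
apply: contra x0 => /eqP Bx0.
by rewrite -[x]mul1mx -CB -mulmxA Bx0 mulmx0.
Qed.

Lemma spdmx_gram (R : realType) (n m : nat) (B : 'M[R]_(n, m)) :
  row_full B -> spdmx (B^T *m B).
Proof. by move=> /(spdmx_congr (spdmx1 R n)); rewrite mulmx1. Qed.

Lemma gram_unit_row_full (R : realType) (n m : nat) (B : 'M[R]_(n, m)) :
  B^T *m B \in unitmx -> row_full B.
Proof.
by move=> uB; apply/row_fullP; exists (invmx (B^T *m B) *m B^T);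
  rewrite -mulmxA mulVmx.
Qed.

Lemma upper_posdiag_unit (R : realType) (m : nat) (U : 'M[R]_m) :
  upper_posdiag U -> U \in unitmx.
Proof.
case=> trU posU; rewrite unitmxE -det_tr det_trig // unitfE gt_eqF //.
by apply: prodr_gt0 => i _; rewrite mxE.
Qed.

(** Induction on the size by Schur complement: for [G] with blocks [g], [h^T], [h], [G'], the factor
    has blocks [a], [h^T / a], [0], [U'], where [a] is the square root of [g] and [U'] is the factor
    of [S = G' - h h^T / g]. *)
Lemma chol_exists (R : realType) (m : nat) (G : 'M[R]_m) :
  spdmx G -> exists U, is_chol G U.
Proof.
elim: m G => [|m IH] G.
  move=> _; exists 0; split; last split; try by [case|apply/matrixP; case].
  by apply/is_trig_mxP; case.
change ('M[R]_(1 + m)) in G.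
move=> -[symG pos].
have posG (x : 'cV_(1 + m)) : x != 0 -> 0 < (x^T *m G *m x) 0 0 := pos x.
set g := ulsubmx G 0 0; set h := dlsubmx G; set G' := drsubmx G.
have Gb : G = block_mx g%:M h^T h G'.
  rewrite /h trmx_dlsub symG /g -mx11_scalar.
  by rewrite -[LHS]submxK.
have symG' : G'^T = G' by rewrite /G' trmx_drsub symG.
have quad a (y : 'cV[R]_m) :
    ((col_mx a%:M y)^T *m G *m col_mx a%:M y) 0 0 =
    a * g * a + (a * (h^T *m y) 0 0) *+ 2 + (y^T *m G' *m y) 0 0.
  rewrite Gb tr_col_mx mul_row_block mul_row_col tr_scalar_mx !mulmxDl.
  have -> : y^T *m h = h^T *m y.
    by rewrite -[RHS]trmxK trmx_mul trmxK [y^T *m h]mx11_scalar tr_scalar_mx.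
  rewrite !mul_mx_scalar !mul_scalar_mx -scalemxAl !mxE /=.
  by rewrite mulr1n mulr2n !mulrA !addrA.
have g0 : 0 < g.
  have := posG (col_mx 1%:M 0).
  rewrite quad !mulmx0 !mxE mulr1 mul1r mul1r mul0rn !addr0.
  by apply; rewrite col_mx_eq0 negb_and -mxrank_eq0 mxrank1.
have gN0 : g != 0 by rewrite gt_eqF.
pose a := Num.sqrt g.
have a0 : 0 < a by rewrite sqrtr_gt0.
have aN0 : a != 0 by rewrite gt_eqF.
have aa : a * a = g by rewrite -expr2 sqr_sqrtr // ltW.
pose S := G' - g^-1 *: (h *m h^T).
have spdS : spdmx S.
  split=> [|y y0].
    by rewrite linearB /= linearZ /= trmx_mul trmxK symG'.
  (* The first coordinate [- c / g] minimizes the form of [G] when the others are [y]; the minimum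
     is [y^T S y]. *)
  set c := (h^T *m y) 0 0.
  have := posG (col_mx (- (c / g))%:M y); rewrite quad col_mx_eq0 negb_and y0 orbT.
  move=> /(_ isT); congr (0 < _).
  have yh : y^T *m h = c%:M.
    by rewrite -[LHS]trmxK trmx_mul trmxK [h^T *m y]mx11_scalar tr_scalar_mx.
  have hy : h^T *m y = c%:M by rewrite [LHS]mx11_scalar.
  have -> : (y^T *m S *m y) 0 0 = (y^T *m G' *m y) 0 0 - g^-1 * (c * c).
    rewrite /S mulmxBr mulmxBl -scalemxAr -scalemxAl [y^T *m (h *m _)]mulmxA.
    by rewrite -[y^T *m h *m _ *m _]mulmxA yh hy -scalar_mxM !mxE mulr1n.
  rewrite hy mxE mulr1n [LHS]addrC; congr (_ + _).
  by field.
change (exists U : 'M[R]_(1 + m), is_chol (m := 1 + m) G U).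
have [U' [UU' [trU' posU']]] := IH _ spdS.
exists (block_mx a%:M (a^-1 *: h^T) 0 U'); split.
  rewrite tr_block_mx mulmx_block Gb [(a^-1 *: _)^T]linearZ /= trmxK tr_scalar_mx trmx0.
  rewrite !mulmx0 !mul0mx !addr0 -scalar_mxM aa mul_scalar_mx scalerA mulfV //.
  rewrite mul_mx_scalar scalerA mulfV // !scale1r UU' -scalemxAl -scalemxAr.
  by rewrite scalerA -invfM aa addrC subrK.
split=> [|i].
  rewrite tr_block_mx is_trig_block_mx // trmx0 eqxx trU' tr_scalar_mx.
  by rewrite scalar_mx_is_trig.
rewrite -[i](@splitK 1 m); case: (split i) => j /=.
  by rewrite block_mxEul mxE ord1 eqxx mulr1n.
by rewrite block_mxEdr.
Qed.

(** The factor is determined row by row from the top: once the rows above [i] are known, [G] gives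
    the products [U_ii U_ij], then [U_ii] as a positive square root, then [U_ij] by division. *)
Lemma chol_unique (R : realType) (m : nat) (G U V : 'M[R]_m) :
  is_chol G U -> is_chol G V -> U = V.
Proof.
move=> [UU [/is_trig_mxP trU posU]] [VV [/is_trig_mxP trV posV]].
have gramE (W : 'M[R]_m) (i j : 'I_m) :
    (forall k l : 'I_m, (k < l)%N -> W^T k l = 0) ->
    (W^T *m W) i j = W i i * W i j + \sum_(k < m | (k < i)%N) W k i * W k j.
  move=> trW; rewrite mxE (bigD1 i) //= !mxE; congr (_ + _).
  rewrite [LHS](bigID (fun k : 'I_m => (k < i)%N)) /= [X in _ + X]big1 ?addr0; last first.
    move=> k /andP[ki]; rewrite -leqNgt leq_eqVlt eq_sym val_eqE (negPf ki) /=.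
    by move=> /trW ->; rewrite mul0r.
  apply: eq_big => k; last by rewrite mxE.
  by case: ltnP => //; rewrite ?andbF // -val_eqE => /ltn_eqF ->.
suff eqW i j : U i j = V i j by apply/matrixP.
have [l] := ubnP (val i); elim: l i j => // l IH i j; rewrite ltnS => il.
have eqlow j' : \sum_(k < m | (k < i)%N) U k i * U k j' =
                \sum_(k < m | (k < i)%N) V k i * V k j'.
  by apply: eq_bigr => k ki; rewrite !IH // (leq_trans ki).
have eqrow j' : U i i * U i j' = V i i * V i j'.
  apply: (addIr (\sum_(k < m | (k < i)%N) U k i * U k j')).
  by rewrite -gramE // UU -VV gramE // eqlow.
have eqd : U i i = V i i.
  by apply/eqP; rewrite -(@eqrXn2 _ 2) ?ltW // !expr2 eqrow.
by have := eqrow j; rewrite eqd; apply: mulfI; rewrite gt_eqF.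
Qed.

(** The triangular factor is the Cholesky factor [U] of [B^T B], and the orthonormal one is
    [B U^-1]. *)
Lemma qr_exists (R : realType) (n m : nat) (B : 'M[R]_(n, m)) :
  row_full B -> is_qr B (qr B).
Proof.
move=> fB; rewrite /qr; case: xgetP => [QU -> //|noqr].
have [U [UU pU]] := chol_exists (spdmx_gram fB).
have uU := upper_posdiag_unit pU.
case: (noqr (B *m invmx U, U)); split=> //=; first by rewrite mulmxKV.
by rewrite trmx_mul trmx_inv mulmxA -[_ *m B^T *m B]mulmxA -UU mulKmx ?unitmx_tr // mulmxV.
Qed.

(** Any triangular factor is a Cholesky factor of [B^T B], hence unique; being invertible, it
    determines the orthonormal factor. *)
Lemma qr_eq (R : realType) (n m : nat) (B Q : 'M[R]_(n, m)) (U : 'M[R]_m) :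
  is_qr B (Q, U) -> qr B = (Q, U).
Proof.
move=> qrQU; have: is_qr B (qr B).
  by rewrite /qr; case: xgetP => [QU -> //|/(_ (Q, U))].
case: (qr B) => Q' U' [/= B1 o1 p1]; case: qrQU => /= B2 o2 p2.
have eU : U' = U.
  apply: (@chol_unique _ _ (B^T *m B)); split=> //.
    by rewrite B1 trmx_mul mulmxA -[_ *m Q'^T *m Q']mulmxA o1 mulmx1.
  by rewrite B2 trmx_mul mulmxA -[_ *m Q^T *m Q]mulmxA o2 mulmx1.
have uU := upper_posdiag_unit p2.
by rewrite eU; congr (_, _); rewrite -(mulmxK uU Q') -{1}eU -B1 B2 mulmxK.
Qed.

Lemma cholP (R : realType) (m : nat) (G : 'M[R]_m) :
  spdmx G -> is_chol G (chol G).
Proof.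
move=> /chol_exists[U cU]; rewrite /chol; case: xgetP => [V -> //|].
by move=> /(_ U).
Qed.

(** * Orthogonality in DP-BCG *)

(** Only the current state enters. [dp_inv_rAp] records conjugacy to the previous direction without
    naming it: [r] and [p psi] differ by a multiple of that direction. *)
Record dp_inv (R : realType) (n m : nat) (A : 'M[R]_n) (s : dp_state R n m) :
    Prop := DPInv {
  dp_inv_pp : (dp_p s)^T *m dp_p s = 1%:M;
  dp_inv_psi : upper_posdiag (dp_psi s);
  dp_inv_pr : (dp_psi s)^T *m ((dp_p s)^T *m dp_r s) = (dp_r s)^T *m dp_r s;
  dp_inv_rAp : (dp_r s)^T *m A *m dp_p s = (dp_psi s)^T *m dp_pAp A s;
  dp_inv_full : row_full (dp_r s) }.

Lemma dp_init_inv (R : realType) (n m : nat) (A : 'M[R]_n)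
    (b x0 : 'M[R]_(n, m)) :
  row_full (b - A *m x0) -> dp_inv A (dp_init A b x0).
Proof.
move=> full_r; have := qr_exists full_r; rewrite /dp_init.
case: (qr _) => p psi [/= Er pp psiP]; split=> //=.
  by rewrite !mulmxA -trmx_mul -Er.
by rewrite /dp_pAp /= Er trmx_mul !mulmxA.
Qed.

Section Step.
Variables (R : realType) (n m : nat) (A : 'M[R]_n) (s : dp_state R n m).
Hypotheses (spdA : spdmx A) (inv_s : dp_inv A s).

Local Notation r := (dp_r s).
Local Notation p := (dp_p s).
Local Notation psi := (dp_psi s).
Local Notation pAp := (dp_pAp A s).
Local Notation gamma := (dp_gamma A s).
Local Notation delta := (dp_delta A s).
Local Notation r' := (dp_rnext A s).

Lemma dp_psi_unit : psi \in unitmx.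
Proof. exact: upper_posdiag_unit (dp_inv_psi inv_s). Qed.

Lemma dp_pAp_spd : spdmx pAp.
Proof.
apply: spdmx_congr spdA _; apply/row_fullP.
by exists p^T; exact: dp_inv_pp inv_s.
Qed.

Let pAp_unit : pAp \in unitmx := spdmx_unit dp_pAp_spd.
Let rr_unit : r^T *m r \in unitmx :=
  spdmx_unit (spdmx_gram (dp_inv_full inv_s)).

Lemma dp_pAp_gamma : pAp *m gamma = p^T *m r.
Proof. by rewrite /dp_gamma mulKVmx. Qed.

Lemma dp_gamma_unit : gamma \in unitmx.
Proof.
have := rr_unit; rewrite -(dp_inv_pr inv_s) -dp_pAp_gamma !unitmx_mul.
by case/and3P.
Qed.

Lemma dp_p_rnext : p^T *m r' = 0.
Proof.
rewrite /dp_rnext; move: gamma dp_pAp_gamma => g Eg.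
by rewrite mulmxBr !mulmxA -/(dp_pAp A s) Eg subrr.
Qed.

(** By [dp_inv_rAp], [r^T A p gamma] is [psi^T pAp gamma = psi^T p^T r], which is [r^T r] by
    [dp_inv_pr]. *)
Lemma dp_r_rnext : r^T *m r' = 0.
Proof.
rewrite /dp_rnext; move: gamma dp_pAp_gamma => g Eg.
by rewrite mulmxBr !mulmxA (dp_inv_rAp inv_s) -mulmxA Eg (dp_inv_pr inv_s) subrr.
Qed.

(** The correction [p delta] drops out because [p] is orthogonal to [r']. The full rank of the
    direction and the next [dp_inv_pr] both rest on this. *)
Lemma dp_rnext_dir : r'^T *m dp_dir A s = r'^T *m r'.
Proof.
rewrite /dp_dir mulmxDr mulmxA -[r'^T *m p]trmxK trmx_mul trmxK dp_p_rnext.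
by rewrite trmx0 mul0mx addr0.
Qed.

Lemma dp_dir_full : row_full r' -> row_full (dp_dir A s).
Proof.
move=> /spdmx_gram /spdmx_unit u.
by apply/row_fullP; exists (invmx (r'^T *m r') *m r'^T);
  rewrite -mulmxA dp_rnext_dir mulVmx.
Qed.

Lemma dp_p_A_dir : p^T *m A *m dp_dir A s = 0.
Proof.
rewrite /dp_dir mulmxDr [X in _ + X]mulmxA -/(dp_pAp A s) /dp_delta mulmxN.
by rewrite mulKVmx // subrr.
Qed.

(** This form brings in the Gram matrices that the [sigma_j] factor. Compute [r^T p delta] twice:
    [r^T p] is [r^T r psi^-1], and it is also [gamma^T pAp], which gives
    [- (r - r')^T r' = r'^T r']. *)
Lemma dp_deltaE : delta = psi *m invmx (r^T *m r) *m (r'^T *m r').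
Proof.
have symA := proj1 spdA; have sympAp := proj1 dp_pAp_spd.
have rp : r^T *m p = r^T *m r *m invmx psi.
  rewrite -[r^T *m r]trmxK trmx_mul trmxK -(dp_inv_pr inv_s) !trmx_mul !trmxK.
  by rewrite mulmxK ?dp_psi_unit.
have rpdelta : r^T *m p *m delta = r'^T *m r'.
  have -> : r^T *m p = gamma^T *m pAp.
    by rewrite -[RHS]trmxK trmx_mul trmxK sympAp dp_pAp_gamma trmx_mul trmxK.
  rewrite /dp_delta mulmxN -[gamma^T *m pAp *m _]mulmxA mulKVmx //.
  have -> : gamma^T *m (p^T *m A *m r') = (r - r')^T *m r'.
    have -> : r - r' = A *m p *m gamma by rewrite opprB addrC subrK.
    by rewrite !trmx_mul symA !mulmxA.
  by rewrite [(r - r')^T]linearB mulmxBl dp_r_rnext sub0r opprK.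
rewrite -rpdelta rp; move: delta (r^T *m r) rr_unit => x G uG.
by rewrite -!mulmxA mulKmx // mulKVmx // dp_psi_unit.
Qed.

Lemma dp_step_dir :
  row_full r' -> dp_p (dp_step A s) *m dp_psi (dp_step A s) = dp_dir A s.
Proof.
move=> /dp_dir_full /qr_exists; rewrite /dp_step.
by case: (qr _) => p' psi' [/= ->].
Qed.

Lemma dp_step_r : dp_r (dp_step A s) = r'.
Proof. by rewrite /dp_step; case: (qr _). Qed.

Lemma dp_step_inv : row_full r' -> dp_inv A (dp_step A s).
Proof.
move=> full_r'; have := qr_exists (dp_dir_full full_r'); rewrite /dp_step.
case: (qr _) => p' psi' [/= Edir pp' psiP']; split=> //=.
  have Edir' : psi'^T *m p'^T = (dp_dir A s)^T by rewrite Edir trmx_mul.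
  rewrite [LHS]mulmxA Edir' -[LHS]trmxK trmx_mul trmxK dp_rnext_dir.
  by rewrite trmx_mul trmxK.
(* For [dp_inv_rAp], the part of [r'] along [p] contributes nothing, since [p'] is conjugate to
   [p]. *)
have Er' : r' = p' *m psi' - p *m delta by rewrite -Edir /dp_dir addrK.
rewrite /dp_pAp /= {1}Er' linearB /= !trmx_mul !mulmxBl -[RHS]subr0 !mulmxA.
congr (_ - _).
have pAp'0 : p^T *m A *m p' = 0.
  apply: (can_inj (mulmxK (upper_posdiag_unit psiP'))).
  by rewrite mul0mx -dp_p_A_dir Edir mulmxA.
by rewrite -!mulmxA [p^T *m _]mulmxA pAp'0 mulmx0.
Qed.

End Step.

(** * Krylov subspaces *)

Section Krylov.
Variables (R : realType) (n m : nat) (A : 'M[R]_n) (v : 'M[R]_(n, m)).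
Local Notation K := (krylov A v).

Lemma krylovS k : K k.+1 = (K k + <<((A ^+ k) *m v)^T>>)%MS.
Proof. by rewrite /krylov big_ord_recr. Qed.

Lemma krylov_subS k : (K k <= K k.+1)%MS.
Proof. by rewrite krylovS addsmxSl. Qed.

Lemma krylov_power k i : (i < k)%N -> (((A ^+ i) *m v)^T <= K k)%MS.
Proof.
by move=> ik; rewrite /krylov (sumsmx_sup (Ordinal ik)) // genmxE.
Qed.

Lemma krylov_sub1 k : (v^T <= K k.+1)%MS.
Proof. by have := @krylov_power k.+1 0 isT; rewrite expr0 mul1mx. Qed.

Lemma krylov_mulS k : (K k *m A^T <= K k.+1)%MS.
Proof.
rewrite {1}/krylov sumsmxMr; apply/sumsmx_subP => i _.
rewrite (eqmxMr _ (genmxE _)) -trmx_mul mulmxA -[A *m _]/(A * _) -exprS.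
by apply: krylov_power; rewrite ltnS.
Qed.

Lemma krylovS_sub k : (K k.+1 <= v^T + K k *m A^T)%MS.
Proof.
rewrite {1}/krylov big_ord_recl addsmx_sub genmxE expr0 mul1mx addsmxSl /=.
apply/sumsmx_subP => i _; rewrite genmxE.
apply: submx_trans (addsmxSr _ _).
by rewrite /bump add1n exprS -[A * _]/(A *m _) -mulmxA trmx_mul submxMr ?krylov_power.
Qed.

Lemma rank_krylovD k l : (\rank (K (k + l)) <= \rank (K k) + l * m)%N.
Proof.
elim: l => [|l IH]; first by rewrite addn0 mul0n addn0.
rewrite addnS krylovS (leq_trans (mxrank_adds_leqif _ _)) // mulSnr addnA.
by rewrite leq_add // genmxE rank_leq_row.
Qed.

(** Each block adds at most [m] dimensions, so a maximal dimension at [k] leaves no deficit at an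
    earlier [l]. *)
Lemma rank_krylov k l :
  (l <= k)%N -> \rank (K k) = (k * m)%N -> \rank (K l) = (l * m)%N.
Proof.
move=> /subnKC Ek rk; apply/eqP; rewrite eqn_leq; apply/andP; split.
  by have := rank_krylovD 0 l; rewrite {2}/krylov big_ord0 mxrank0.
have := rank_krylovD l (k - l); rewrite Ek rk -{1}Ek mulnDl.
by rewrite leq_add2r.
Qed.

End Krylov.

Lemma dpbcg_inv (R : realType) (n m : nat) (A : 'M[R]_n)
    (b x0 : 'M[R]_(n, m)) (k : nat) :
  spdmx A -> \rank (krylov A (b - A *m x0) k.+1) = (k.+1 * m)%N ->
  forall j, (j <= k)%N -> dp_inv A (dpbcg A b x0 j).
Proof.
move=> spdA rk; pose K := krylov A (b - A *m x0); pose S := dpbcg A b x0.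
(* The induction also carries Krylov inclusions; the last says that [p_j] supplies everything that
   [K_(j+1)] has beyond [K_j]. *)
suff H j : (j <= k)%N -> [/\ dp_inv A (S j), ((dp_r (S j))^T <= K j.+1)%MS,
    ((dp_p (S j))^T <= K j.+1)%MS & (K j.+1 <= K j + (dp_p (S j))^T)%MS].
  by move=> j /H[].
elim: j => [_|j IH jk].
  have full : row_full (b - A *m x0).
    rewrite /row_full -[in X in _ == X](mul1n m).
    rewrite -(rank_krylov (isT : (1 <= k.+1)%N) rk) krylovS /krylov big_ord0.
    by rewrite adds0mx genmxE expr0 mul1mx mxrank_tr.
  have inv0 : dp_inv A (S 0%N) := dp_init_inv full.
  have Er : dp_r (S 0%N) = b - A *m x0 by rewrite /S /= /dp_init; case: qr.
  have Ep : dp_p (S 0%N) *m dp_psi (S 0%N) = b - A *m x0.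
    have := qr_exists full.
    by rewrite /S /= /dp_init; case: (qr _) => ? ? [/= <-].
  have rK : (((b - A *m x0)^T) <= K 1%N)%MS := krylov_sub1 _ _ _.
  have upsi := upper_posdiag_unit (dp_inv_psi inv0).
  split=> //.
  - by rewrite Er.
  - apply: submx_trans rK; rewrite -[dp_p _](mulmxK upsi) Ep trmx_mul.
    exact: submxMl.
  - rewrite (submx_trans (krylovS_sub _ _ _)) // addsmx_sub -Ep trmx_mul.
    rewrite (submx_trans _ (addsmxSr _ _)) ?submxMl //=.
    by rewrite /krylov big_ord0 mul0mx sub0mx.
have [inv rK pK Kp] := IH (ltnW jk).
set s := S j in inv rK pK Kp; set r := dp_r s in rK; set p := dp_p s in pK Kp.
pose r' := dp_rnext A s.
have ES : S j.+1 = dp_step A s by [].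
have ApE : p^T *m A^T = (invmx (dp_gamma A s))^T *m (r - r')^T.
  have ug := dp_gamma_unit spdA inv.
  rewrite -!trmx_mul; congr _^T.
  have -> : r - r' = A *m p *m dp_gamma A s by rewrite opprB addrC subrK.
  by rewrite mulmxK.
have pAK : (p^T *m A^T <= K j.+2)%MS.
  exact: submx_trans (submxMr _ pK) (krylov_mulS _ _ _).
have r'K : (r'^T <= K j.+2)%MS.
  rewrite linearB /= addmx_sub ?eqmx_opp ?(submx_trans rK) ?krylov_subS //.
  by rewrite !trmx_mul mulmx_sub.
(* Apply [A] to the last inclusion: [A K_j] stays in [K_(j+1)], and [A p_j] is a combination of
   [r_j] and [r_(j+1)]. *)
have Kr' : (K j.+2 <= K j.+1 + r'^T)%MS.
  apply: submx_trans (krylovS_sub _ _ _) _; rewrite addsmx_sub; apply/andP; split.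
    exact: submx_trans (krylov_sub1 _ _ _) (addsmxSl _ _).
  apply: submx_trans (submxMr _ Kp) _; rewrite addsmxMr addsmx_sub; apply/andP; split.
    exact: submx_trans (krylov_mulS _ _ _) (addsmxSl _ _).
  rewrite ApE mulmx_sub // linearB /= addmx_sub // ?eqmx_opp ?addsmxSr //.
  exact: submx_trans rK (addsmxSl _ _).
(* The dimension grows by exactly [m] from [K_(j+1)] to [K_(j+2)], and only [r'] can supply the
   growth. *)
have full' : row_full r'.
  rewrite /row_full eqn_leq rank_leq_col /=.
  have := leq_trans (mxrankS Kr') (mxrank_adds_leqif _ _).
  rewrite !(rank_krylov _ rk) ?ltnS ?(ltnW jk) // mulSnr leq_add2l.
  by rewrite mxrank_tr.
have inv' : dp_inv A (S j.+1) by exact: dp_step_inv.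
have Ep := dp_step_dir spdA inv full'.
have upsi := upper_posdiag_unit (dp_inv_psi inv').
split=> //.
- by rewrite ES dp_step_r.
- rewrite -[dp_p _](mulmxK upsi) Ep trmx_mul mulmx_sub // linearD /= addmx_sub //.
  by rewrite trmx_mul mulmx_sub // (submx_trans pK) ?krylov_subS.
(* The new direction may replace [r'], as the term [p delta] lies in [K_(j+1)]. *)
- apply: submx_trans Kr' _; rewrite addsmx_sub addsmxSl /=.
  have -> : r' = dp_p (S j.+1) *m dp_psi (S j.+1) - p *m dp_delta A s.
    by rewrite Ep addrK.
  rewrite linearB /= addmx_sub ?eqmx_opp // trmx_mul mulmx_sub ?addsmxSr //.
  exact: submx_trans pK (addsmxSl _ _).
Qed.

(** * Block LDL factorizations of block tridiagonal matrices *)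

(** Block row [i] of a lower bidiagonal matrix is zero outside columns [i] and [i - 1], so block
    products collapse to these two terms. *)
Lemma sum_ord_two (V : zmodType) (K i : nat) (F : nat -> V) :
  (i < K)%N -> (forall a, a != i -> a.+1 != i -> F a = 0) ->
  \sum_(a < K) F a = F i + (if i is i'.+1 then F i' else 0).
Proof.
move=> iK F0; rewrite (bigD1 (Ordinal iK)) //=; congr (_ + _).
case: i iK F0 => [|i] iK F0.
  by rewrite big1 // => a ai; apply: F0.
rewrite (bigD1 (Ordinal (ltnW iK))) /=; last by rewrite -val_eqE /= ltn_eqF.
by rewrite big1 ?addr0 // => a /andP[a1 a2]; apply: F0.
Qed.

Lemma block_ldl_prodE (R : realType) (m K : nat) (ell d : nat -> 'M[R]_m) :
  block_unit_bidiag K ell *m block_diag K d *m (block_unit_bidiag K ell)^T =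
  \mxblock_(i < K, j < K)
    (if i == j :> nat then
       d i.+1 + (if (i : nat) is i'.+1 then ell i *m d i *m (ell i)^T else 0)
     else if i == j.+1 :> nat then ell i *m d i
     else if j == i.+1 :> nat then d j *m (ell j)^T
     else 0).
Proof.
rewrite /block_unit_bidiag /block_diag tr_mxblock mul_mxblock_mxdiag mul_mxblock.
apply: eq_mxblock => i j.
pose L i a : 'M[R]_m :=
  if i == a :> nat then 1%:M else if i == a.+1 :> nat then ell a.+1 else 0.
rewrite (@sum_ord_two _ K i (fun a => L i a *m d a.+1 *m (L j a)^T)) //; last first.
  by move=> a /negPf ai /negPf a1i; rewrite /L eq_sym ai eq_sym a1i !mul0mx.
rewrite /L eqxx mul1mx; move: (i : nat) (j : nat) => {L}i {}j.
have [<-|ij] := eqVneq i j.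
  rewrite trmx1 mulmx1; case: i => // i.
  by rewrite eqxx (gtn_eqF (ltnSn _)).
have [-> {i ij}|ij'] := eqVneq i j.+1.
  rewrite !eqxx (gtn_eqF (ltnSn _)) (ltn_eqF (leqnSn _)).
  by rewrite trmx0 mulmx0 add0r trmx1 mulmx1.
have [-> {j ij ij'}|ji] := eqVneq j i.+1.
  case: i => [|i]; first by rewrite addr0.
  rewrite (gtn_eqF (leqnSn _)) (gtn_eqF (ltnSn i.+1)).
  by rewrite trmx0 mulmx0 addr0.
rewrite trmx0 mulmx0 add0r; case: i ij ij' ji => // i ij ij' ji.
rewrite eqxx (gtn_eqF (ltnSn _)) [j == i]eq_sym -eqSS (negPf ij') [j == _]eq_sym.
by rewrite (negPf ij) trmx0 mulmx0.
Qed.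

(** The equations below and above the diagonal are both kept, because [d] is not assumed
    symmetric. *)
Lemma block_ldlP (R : realType) (m K : nat) (alpha beta ell d : nat -> 'M[R]_m) :
  is_block_ldl (block_tridiag K alpha beta) ell d <->
  (forall j, (j < K)%N -> alpha j.+1 =
     d j.+1 + (if j is j'.+1 then ell j *m d j *m (ell j)^T else 0)) /\
  (forall j, (1 <= j < K)%N ->
     beta j.+1 = ell j *m d j /\ (beta j.+1)^T = d j *m (ell j)^T).
Proof.
rewrite /is_block_ldl block_ldl_prodE /block_tridiag -eq_mxblockP; split.
  move=> H; split=> [j jK|[//|j] /= jK].
    by have := H (Ordinal jK) (Ordinal jK); rewrite /= eqxx.
  have := H (Ordinal jK) (Ordinal (ltnW jK)).
  have := H (Ordinal (ltnW jK)) (Ordinal jK).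
  by rewrite /= !eqxx (gtn_eqF (ltnSn _)) (ltn_eqF (ltnSn _)) (ltn_eqF (leqnSn _)).
case=> [Ha Hb] i j; have [_|_] := eqVneq (i : nat) j; first exact: Ha.
have [ij|_] := eqVneq (i : nat) j.+1.
  by have iK := ltn_ord i; rewrite ij in iK *; exact: proj1 (Hb j.+1 iK).
have [ji|//] := eqVneq (j : nat) i.+1.
by have jK := ltn_ord j; rewrite ji in jK *; exact: proj2 (Hb i.+1 jK).
Qed.

(** Block elimination: [d_j] and [beta_(j+1)] give [ell_j], then the diagonal gives [d_(j+1)]. Only
    [d_1, ..., d_k] are inverted, so a last block [d_(k+1)] may be singular. *)
Lemma block_ldl_unique (R : realType) (m K k : nat)
    (alpha beta ell d ell' d' : nat -> 'M[R]_m) :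
  (forall j, (1 <= j <= k)%N -> d j \in unitmx) ->
  is_block_ldl (block_tridiag K alpha beta) ell d ->
  is_block_ldl (block_tridiag K alpha beta) ell' d' ->
  forall j, (j < K)%N -> (j <= k)%N ->
  d' j.+1 = d j.+1 /\ ((0 < j)%N -> ell' j = ell j).
Proof.
move=> ud /block_ldlP[Ha Hb] /block_ldlP[Ha' Hb'].
elim=> [|j IH] jK jk.
  by have := Ha' _ jK; rewrite (Ha _ jK) !addr0.
have [Ed _] := IH (ltnW jK) (ltnW jk).
have Eell : ell' j.+1 = ell j.+1.
  have [+ _] := Hb' _ (jK : (1 <= j.+1 < K)%N).
  rewrite (proj1 (Hb j.+1 jK)) Ed => /(can_inj (mulmxK (ud j.+1 jk)))//.
split=> [|//]; have := Ha' _ jK; rewrite (Ha _ jK) Ed Eell.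
by move=> /addIr.
Qed.

(** * From DP-BCG to block Lanczos *)

(** A three-term relation with orthonormal blocks must be the Lanczos step: multiplying by [v^T]
    isolates [alpha'], and the remainder [v' beta'] is already a QR factorization. *)
Lemma bl_stepE (R : realType) (n m : nat) (A : 'M[R]_n)
    (v0 v v' : 'M[R]_(n, m)) (beta alpha' beta' : 'M[R]_m) :
  let s := BLState v0 v beta in
  v^T *m v = 1%:M -> v^T *m v' = 0 -> v'^T *m v' = 1%:M ->
  upper_posdiag beta' -> A *m v - v0 *m beta^T = v *m alpha' + v' *m beta' ->
  [/\ bl_alpha A s = alpha', row_full (bl_resid A s) &
      bl_step A s = BLState v v' beta'].
Proof.
move=> s vv vv' v'v' posb Ew.
have Ea : bl_alpha A s = alpha'.
  by rewrite /bl_alpha /bl_w /= Ew mulmxDr !mulmxA vv vv' mul1mx mul0mx addr0.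
have Er : bl_resid A s = v' *m beta'.
  by rewrite /bl_resid Ea /bl_w /= Ew addrC addKr.
split=> //.
  rewrite Er; apply: gram_unit_row_full; rewrite trmx_mul mulmxA.
  rewrite -[_ *m v'^T *m v']mulmxA v'v' mulmx1 unitmx_mul unitmx_tr.
  by rewrite upper_posdiag_unit.
by rewrite /bl_step (@qr_eq _ _ _ _ v' beta') // Er.
Qed.

Section Recurrences.
Variables (R : realType) (n m : nat) (A : 'M[R]_n).
Variables (b x0 : 'M[R]_(n, m)) (k : nat).
Variables (r p : nat -> 'M[R]_(n, m)) (psi gamma : nat -> 'M[R]_m).
Variables (sigma theta tau d ell alpha beta : nat -> 'M[R]_m).
Local Notation S := (dpbcg A b x0).

Hypotheses (spdA : spdmx A)
  (rankK : \rank (krylov A (b - A *m x0) k.+1) = (k.+1 * m)%N)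
  (rE : forall j, r j = dp_r (S j)) (pE : forall j, p j = dp_p (S j))
  (psiE : forall j, psi j = dp_psi (S j))
  (gammaE : forall j, gamma j = dp_gamma A (S j))
  (sigma0 : sigma 0%N = psi 0%N) (beta1 : beta 1%N = sigma 0%N)
  (theta0 : theta 0%N = 1%:M) (ell0 : ell 0%N = 0)
  (recE : forall j, (1 <= j <= k)%N ->
    [/\ tau j = invmx (gamma j.-1) *m psi j.-1 *m invmx (sigma j.-1)
                  *m theta j.-1,
        d j = (theta j.-1)^T *m sigma j.-1 *m tau j &
        alpha j = d j + ell j.-1 *m (beta j)^T] /\
    [/\ sigma j = chol ((psi j)^T *m (p j)^T *m r j),
        (theta j, beta j.+1) = qr (sigma j *m tau j) &
        ell j = (theta j)^T *m sigma j *m invmx (sigma j.-1) *m theta j.-1]).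

Let inv j (jk : (j <= k)%N) : dp_inv A (S j) := dpbcg_inv spdA rankK jk.

Lemma rec_tau j : (j < k)%N ->
  tau j.+1 = invmx (gamma j) *m psi j *m invmx (sigma j) *m theta j.
Proof. by move=> jk; have [[]] := @recE j.+1 jk. Qed.

Lemma rec_d j : (j < k)%N -> d j.+1 = (theta j)^T *m sigma j *m tau j.+1.
Proof. by move=> jk; have [[]] := @recE j.+1 jk. Qed.

Lemma rec_alpha j : (j < k)%N -> alpha j.+1 = d j.+1 + ell j *m (beta j.+1)^T.
Proof. by move=> jk; have [[]] := @recE j.+1 jk. Qed.

Lemma rec_ell j : (j < k)%N ->
  ell j.+1 = (theta j.+1)^T *m sigma j.+1 *m invmx (sigma j) *m theta j.
Proof. by move=> jk; have [_ []] := @recE j.+1 jk. Qed.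

Lemma rec_gram_spd j : (j <= k)%N -> spdmx ((r j)^T *m r j).
Proof. by move=> jk; rewrite rE; exact: spdmx_gram (dp_inv_full (inv jk)). Qed.

Lemma rec_psi_p_r j :
  (j <= k)%N -> (psi j)^T *m (p j)^T *m r j = (r j)^T *m r j.
Proof. by move=> jk; rewrite psiE pE rE -mulmxA (dp_inv_pr (inv jk)). Qed.

Lemma rec_r0_full : row_full (b - A *m x0).
Proof.
have := dp_inv_full (inv (leq0n k)).
by rewrite /= /dp_init; case: (qr _).
Qed.

Lemma rec_r0 : r 0%N = p 0%N *m psi 0%N.
Proof.
have := qr_exists rec_r0_full.
by rewrite rE pE psiE /= /dp_init; case: (qr _) => ? ? [/= <-].
Qed.

Lemma rec_sigma j :
  (j <= k)%N -> is_chol ((r j)^T *m r j) (sigma j).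
Proof.
case: j => [|j] jk.
  have i0 := inv (leq0n k).
  split; rewrite sigma0 psiE; last exact: dp_inv_psi i0.
  rewrite rec_r0 psiE pE trmx_mul mulmxA -[_ *m _ *m dp_p _]mulmxA.
  by rewrite (dp_inv_pp i0) mulmx1.
have [_ [-> _ _]] := @recE j.+1 jk.
by rewrite rec_psi_p_r //; apply/cholP/rec_gram_spd.
Qed.

Lemma rec_sigma_unit j : (j <= k)%N -> sigma j \in unitmx.
Proof. by case/rec_sigma=> _ /upper_posdiag_unit. Qed.

Lemma rec_gamma_unit j : (j <= k)%N -> gamma j \in unitmx.
Proof. by move=> /inv; rewrite gammaE; exact: dp_gamma_unit. Qed.

Lemma rec_psi_unit j : (j <= k)%N -> psi j \in unitmx.
Proof. by move=> /inv; rewrite psiE; exact: dp_psi_unit. Qed.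

(** The argument of [qr] is a product of invertible matrices, among them the previous [theta]; hence
    the induction. At index 0, [theta] is the identity by convention, not a QR factor. *)
Lemma rec_theta j : (j <= k)%N ->
  (theta j)^T *m theta j = 1%:M /\
  ((0 < j)%N -> is_qr (sigma j *m tau j) (theta j, beta j.+1)).
Proof.
elim: j => [|j IH] jk; first by rewrite theta0 trmx1 mulmx1.
have [/mulmx1_unit[_ utheta] _] := IH (ltnW jk).
suff qrj : is_qr (sigma j.+1 *m tau j.+1) (theta j.+1, beta j.+2).
  by split=> //; case: qrj.
have [_ [_ -> _]] := @recE j.+1 jk; apply: qr_exists.
rewrite row_full_unit unitmx_mul rec_sigma_unit // rec_tau //.
rewrite !unitmx_mul !unitmx_inv utheta.
by rewrite rec_gamma_unit ?rec_psi_unit ?rec_sigma_unit // ltnW.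
Qed.

Lemma rec_theta_orth j : (j <= k)%N -> (theta j)^T *m theta j = 1%:M.
Proof. by case/rec_theta. Qed.

Lemma rec_theta_orthr j : (j <= k)%N -> theta j *m (theta j)^T = 1%:M.
Proof. by move=> /rec_theta_orth/mulmx1C. Qed.

Lemma rec_theta_unit j : (j <= k)%N -> theta j \in unitmx.
Proof. by move=> /rec_theta_orth/mulmx1_unit[]. Qed.

Lemma rec_beta j : (j < k)%N ->
  sigma j.+1 *m tau j.+1 = theta j.+1 *m beta j.+2 /\ upper_posdiag (beta j.+2).
Proof. by move=> jk; have [_ /(_ isT)[]] := rec_theta jk. Qed.

(** Up to a sign that cancels, this is [u_j^T A u_j]; it shows the symmetry and positivity of [d]
    that the recurrence hides. *)
Lemma rec_dE j : (j < k)%N ->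
  d j.+1 = (psi j *m invmx (sigma j) *m theta j)^T *m dp_pAp A (S j)
             *m (psi j *m invmx (sigma j) *m theta j).
Proof.
move=> jk; have jk' := ltnW jk.
(* Multiply by [gamma] on the right: both sides become [sigma], since [psi^T pAp gamma = psi^T p^T r
   = sigma^T sigma]. *)
have Gs : sigma j *m invmx (gamma j) =
          (invmx (sigma j))^T *m (psi j)^T *m dp_pAp A (S j).
  have [sr _] := rec_sigma jk'.
  apply: (can_inj (mulmxK (rec_gamma_unit jk'))).
  rewrite mulmxKV ?rec_gamma_unit // -[_ *m dp_pAp _ _ *m _]mulmxA gammaE.
  rewrite (dp_pAp_gamma spdA (inv jk')) -mulmxA.
  rewrite psiE (dp_inv_pr (inv jk')) -rE -sr trmx_inv mulKmx //.
  by rewrite unitmx_tr rec_sigma_unit.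
rewrite rec_d // rec_tau // !trmx_mul !mulmxA.
by rewrite -[_ *m sigma j *m _]mulmxA Gs !mulmxA.
Qed.

Lemma rec_d_spd j : (j < k)%N -> spdmx (d j.+1).
Proof.
move=> jk; have jk' := ltnW jk; rewrite rec_dE //.
apply: spdmx_congr (dp_pAp_spd spdA (inv jk')) _.
rewrite row_full_unit !unitmx_mul unitmx_inv.
by rewrite rec_psi_unit ?rec_sigma_unit ?rec_theta_unit.
Qed.

(** In the product, [theta_j theta_j^T] and [sigma_j^-1 sigma_j] cancel, leaving
    [theta_(j+1)^T sigma_(j+1) tau_(j+1)]. *)
Lemma rec_beta_ell j : (j < k)%N -> beta j.+2 = ell j.+1 *m d j.+1.
Proof.
move=> jk; have jk' := ltnW jk; have [Eb _] := rec_beta jk.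
rewrite rec_ell // rec_d // !mulmxA -[_ *m theta j *m _]mulmxA rec_theta_orthr // mulmx1.
rewrite mulmxKV ?rec_sigma_unit // -mulmxA Eb mulmxA rec_theta_orth //.
by rewrite mul1mx.
Qed.

Lemma rec_beta_tr j : (j < k)%N -> (beta j.+2)^T = d j.+1 *m (ell j.+1)^T.
Proof. by move=> jk; rewrite rec_beta_ell // trmx_mul (rec_d_spd jk).1. Qed.

(* Indexed from 0: [rec_v j] is the Lanczos block v_(j+1). *)
Definition rec_v j := (-1) ^+ j *: (r j *m invmx (sigma j) *m theta j).

Definition rec_u j :=
  (-1) ^+ j *: (p j *m psi j *m invmx (sigma j) *m theta j).

Lemma rec_v_orth j : (j <= k)%N -> (rec_v j)^T *m rec_v j = 1%:M.
Proof.
move=> jk; have us := rec_sigma_unit jk; have [sr _] := rec_sigma jk.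
rewrite /rec_v [(_ *: _)^T]linearZ /= -scalemxAl -scalemxAr scalerA -expr2 sqrr_sign scale1r.
rewrite !trmx_mul !mulmxA -[_ *m (r j)^T *m r j]mulmxA -sr trmx_inv !mulmxA.
by rewrite mulmxKV ?unitmx_tr // mulmxK // rec_theta_orth.
Qed.

Lemma rec_r_succ j : r j.+1 = r j - A *m p j *m gamma j.
Proof. by rewrite rE rE pE gammaE dp_step_r. Qed.

Lemma rec_v_v j : (j < k)%N -> (rec_v j)^T *m rec_v j.+1 = 0.
Proof.
move=> jk; rewrite /rec_v [(_ *: _)^T]linearZ /= -scalemxAl -scalemxAr.
rewrite !trmx_mul !mulmxA -[_ *m (r j)^T *m _]mulmxA !rE dp_step_r.
by rewrite (dp_r_rnext spdA (inv (ltnW jk))) mulmx0 !mul0mx !scaler0.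
Qed.

Lemma rec_rE j : (j <= k)%N -> r j = (-1) ^+ j *: (rec_v j *m (theta j)^T *m sigma j).
Proof.
move=> jk; rewrite /rec_v -!scalemxAl scalerA -expr2 sqrr_sign scale1r.
by rewrite -[_ *m theta j *m _]mulmxA rec_theta_orthr // mulmx1 mulmxKV // rec_sigma_unit.
Qed.

(** [A p_j] is [(r_j - r_(j+1)) gamma_j^-1], and [tau] collects the factors to its right. The
    alternating sign in [rec_v] turns the minus into a plus. *)
Lemma rec_A_u j : (j < k)%N ->
  A *m rec_u j = rec_v j *m d j.+1 + rec_v j.+1 *m beta j.+2.
Proof.
move=> jk; have jk' := ltnW jk.
have ApE : A *m p j = (r j - r j.+1) *m invmx (gamma j).
  by rewrite rec_r_succ opprB addrC subrK mulmxK // rec_gamma_unit.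
rewrite /rec_u -scalemxAr !mulmxA ApE -!mulmxA.
rewrite [invmx (gamma j) *m _](_ : _ = tau j.+1); last by rewrite rec_tau // !mulmxA.
rewrite mulmxBl (rec_rE jk') (rec_rE jk).
move: (rec_v j) (rec_v j.+1) => V V'.
rewrite -!scalemxAl scalerBr !scalerA exprS.
rewrite mulrCA -expr2 sqrr_sign mulr1 scale1r scaleN1r opprK rec_d // !mulmxA.
congr (_ + _); have [Eb _] := rec_beta jk.
rewrite -[_ *m sigma j.+1 *m _]mulmxA Eb mulmxA -[_ *m theta j.+1]mulmxA rec_theta_orth //.
by rewrite mulmx1.
Qed.

Lemma rec_u0 : rec_u 0 = rec_v 0.
Proof. by rewrite /rec_u /rec_v -rec_r0. Qed.

(** This is the update of the direction times [sigma_(j+1)^-1 theta_(j+1)]. By [dp_deltaE], [delta]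
    is [psi_j sigma_j^-1 sigma_j^-T sigma_(j+1)^T sigma_(j+1)], which produces [ell^T]. *)
Lemma rec_v_u j : (j < k)%N -> rec_v j.+1 = rec_u j.+1 + rec_u j *m (ell j.+1)^T.
Proof.
move=> jk; have jk' := ltnW jk.
have full' : row_full (dp_rnext A (S j)) by rewrite -dp_step_r (dp_inv_full (inv jk)).
have Edir : p j.+1 *m psi j.+1 = r j.+1 + p j *m dp_delta A (S j).
  by rewrite !pE psiE (dp_step_dir spdA (inv jk') full') rE dp_step_r.
have [sr _] := rec_sigma jk'; have [sr' _] := rec_sigma jk.
rewrite {1}/rec_u Edir !mulmxDl scalerDr -/(rec_v j.+1) -[LHS]addr0 -addrA.
congr (_ + _); apply/esym.
rewrite (dp_deltaE spdA (inv jk')) -rE -dp_step_r -psiE -(rE j.+1).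
rewrite -sr -sr' rec_ell // /rec_u !trmx_mul trmxK exprS mulN1r scaleNr -scalemxAl.
apply/eqP; rewrite addrC subr_eq0; apply/eqP; congr (_ *: _).
have us := rec_sigma_unit jk'; have us' := rec_sigma_unit jk.
have -> : invmx ((sigma j)^T *m sigma j) = invmx (sigma j) *m (invmx (sigma j))^T.
  have uG : (sigma j)^T *m sigma j \in unitmx by rewrite unitmx_mul unitmx_tr us.
  rewrite -[RHS](mulKmx uG) -[_ *m sigma j *m _]mulmxA mulKVmx //.
  by rewrite trmx_inv mulmxV ?unitmx_tr // mulmx1.
rewrite !mulmxA.
by rewrite mulmxK // -[_ *m theta j *m _]mulmxA rec_theta_orthr // mulmx1.
Qed.

(** Expand [A v] through [rec_v_u] and [rec_A_u]: the part along the previous block is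
    [d ell^T = beta^T], which the subtraction removes. *)
Lemma rec_w j : (j < k)%N ->
  A *m rec_v j - (if j is i.+1 then rec_v i else 0) *m (beta j.+1)^T =
  rec_v j *m alpha j.+1 + rec_v j.+1 *m beta j.+2.
Proof.
move=> jk; rewrite rec_alpha //; case: j jk => [|j] jk.
  by rewrite -{1}rec_u0 rec_A_u // ell0 !mul0mx subr0 addr0.
have jk' := ltnW jk; rewrite {1}rec_v_u // mulmxDr mulmxA !rec_A_u //.
(* Both sides are [ell d ell^T], the correction contained in [alpha]. *)
have Ebl : ell j.+1 *m (beta j.+2)^T = beta j.+2 *m (ell j.+1)^T.
  by rewrite rec_beta_tr // mulmxA -rec_beta_ell.
rewrite mulmxDr Ebl mulmxDl -!mulmxA -rec_beta_tr //.
by rewrite [X in _ + X - _]addrC addrA addrK addrAC.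
Qed.

Lemma lanczosE j : (j <= k)%N ->
  lanczos A (b - A *m x0) j.+1 =
  BLState (if j is i.+1 then rec_v i else 0) (rec_v j) (beta j.+1).
Proof.
elim: j => [|j IH] jk.
  (* At the start [r_0 psi_0^-1 = p_0], so both algorithms begin with the same QR factorization. *)
  rewrite /lanczos /= /rec_v expr0 scale1r theta0 mulmx1 beta1 sigma0 rec_r0.
  rewrite mulmxK ?rec_psi_unit // pE psiE /bl_init /= /dp_init.
  by case: (qr _).
have jk' := ltnW jk; have [_ pb] := rec_beta jk.
rewrite /lanczos iterS -/(lanczos A (b - A *m x0) j.+1) IH //.
by case: (bl_stepE (rec_v_orth jk') (rec_v_v jk) (rec_v_orth jk) pb (rec_w jk)).
Qed.

Lemma lanczos_alphaE j : (j < k)%N ->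
  lanczos_alpha A (b - A *m x0) j.+1 = alpha j.+1 /\
  row_full (bl_resid A (lanczos A (b - A *m x0) j.+1)).
Proof.
move=> jk; have jk' := ltnW jk; have [_ pb] := rec_beta jk.
rewrite /lanczos_alpha lanczosE //.
by case: (bl_stepE (rec_v_orth jk') (rec_v_v jk) (rec_v_orth jk) pb (rec_w jk)).
Qed.

Lemma lanczos_betaE j :
  (j <= k)%N -> lanczos_beta A (b - A *m x0) j.+1 = beta j.+1.
Proof. by move=> jk; rewrite /lanczos_beta lanczosE. Qed.

(** [d'] is a parameter in order to cover [K = k + 1] too, where the recurrences give no [d_(k+1)]
    and the Schur complement takes its place. *)
Lemma rec_ldl K (d' : nat -> 'M[R]_m) :
  (K <= k.+1)%N -> (forall j, (1 <= j <= k)%N -> d' j = d j) ->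
  (K = k.+1 -> d' k.+1 = lanczos_alpha A (b - A *m x0) k.+1
                           - ell k *m d k *m (ell k)^T) ->
  is_block_ldl (block_tridiag K (lanczos_alpha A (b - A *m x0))
                  (lanczos_beta A (b - A *m x0))) ell d'.
Proof.
move=> Kk Ed' Edk; apply/block_ldlP; split=> [j jK|[//|j] /= jK].
  have jk : (j <= k)%N := leq_trans jK Kk.
  move: jk; rewrite leq_eqVlt => /predU1P[Ejk|jk].
    rewrite Ejk Edk; last by apply/eqP; rewrite eqn_leq Kk -Ejk.
    case: (posnP k) => [Ek|]; first by rewrite Ek ell0 !mul0mx subr0 addr0.
    by case: (k) (Ed' k) => // i -> //; rewrite ?leqnn // subrK.
  rewrite (lanczos_alphaE jk).1 rec_alpha // Ed' //.
  case: j jK jk => [|j] _ jk; first by rewrite ell0 mul0mx.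
  by rewrite Ed' ?(ltnW jk) // rec_beta_tr ?mulmxA // ltnW.
have jk : (j < k)%N := leq_trans jK Kk.
by rewrite lanczos_betaE // Ed' // rec_beta_tr // rec_beta_ell.
Qed.

(** [theta] is orthogonal, so its inverse transpose is [theta] itself. *)
Lemma rec_lanczos_v :
  lanczos_v A (b - A *m x0) k.+1 =
  (-1) ^+ k *: (r k *m invmx (sigma k) *m invmx (theta k)^T).
Proof.
have -> : invmx (theta k)^T = theta k.
  have uT : (theta k)^T \in unitmx by rewrite unitmx_tr rec_theta_unit.
  by rewrite -[RHS](mulKmx uT) rec_theta_orth // mulmx1.
by rewrite /lanczos_v lanczosE.
Qed.
End Recurrences.

Theorem theorem4 (R : realType) (n m : nat) (A : 'M[R]_n)
    (b x0 : 'M[R]_(n, m)) (k : nat)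
    (r p : nat -> 'M[R]_(n, m)) (psi gamma : nat -> 'M[R]_m)
    (sigma theta tau d ell alpha beta : nat -> 'M[R]_m) :
  spdmx A ->
  (1 <= k)%N ->
  \rank (krylov A (b - A *m x0) k.+1) = (k.+1 * m)%N ->
  (* the quantities of DP-BCG *)
  (forall j, r j = dp_r (dpbcg A b x0 j)) ->
  (forall j, p j = dp_p (dpbcg A b x0 j)) ->
  (forall j, psi j = dp_psi (dpbcg A b x0 j)) ->
  (forall j, gamma j = dp_gamma A (dpbcg A b x0 j)) ->
  (* the recurrences *)
  sigma 0%N = psi 0%N ->
  beta 1%N = sigma 0%N ->
  theta 0%N = 1%:M ->
  ell 0%N = 0 ->
  (forall j, (1 <= j <= k)%N ->
    [/\ tau j = invmx (gamma j.-1) *m psi j.-1 *m invmx (sigma j.-1)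
                  *m theta j.-1,
        d j = (theta j.-1)^T *m sigma j.-1 *m tau j &
        alpha j = d j + ell j.-1 *m (beta j)^T] /\
    [/\ sigma j = chol ((psi j)^T *m (p j)^T *m r j),
        (theta j, beta j.+1) = qr (sigma j *m tau j) &
        ell j = (theta j)^T *m sigma j *m invmx (sigma j.-1) *m theta j.-1]) ->
  let v := lanczos_v A (b - A *m x0) in
  let alphaL := lanczos_alpha A (b - A *m x0) in
  let betaL := lanczos_beta A (b - A *m x0) in
  (* both algorithms and the recurrences are well defined *)
  [/\ lanczos_runs A (b - A *m x0) k,
      dpbcg_runs A b x0 k,
      forall j, (j < k)%N -> gamma j \in unitmx,
      forall j, (j <= k)%N -> sigma j \in unitmx /\ theta j \in unitmx &
      forall j, (1 <= j <= k)%N ->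
        spdmx ((psi j)^T *m (p j)^T *m r j) /\ row_full (sigma j *m tau j)] /\
  (* the recurrences yield the block Lanczos coefficients *)
  (forall j, (1 <= j <= k)%N -> alpha j = alphaL j /\ beta j.+1 = betaL j.+1) /\
  (* d_1, ..., d_k and ell_1, ..., ell_(k-1) are the coefficients of the
     factorization of T_k, and ell_k belongs to that of T_(k+1) *)
  is_block_ldl (block_tridiag k alphaL betaL) ell d /\
  (exists ell' d' : nat -> 'M[R]_m,
     is_block_ldl (block_tridiag k.+1 alphaL betaL) ell' d') /\
  (forall (K : nat) (ell' d' : nat -> 'M[R]_m), (k <= K <= k.+1)%N ->
     is_block_ldl (block_tridiag K alphaL betaL) ell' d' ->
     (forall j, (1 <= j < K)%N -> ell' j = ell j) /\
     (forall j, (1 <= j <= k)%N -> d' j = d j)) /\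
  (* reconstruction of the Lanczos block *)
  v k.+1 = (-1) ^+ k *: (r k *m invmx (sigma k) *m invmx (theta k)^T).
Proof.
move=> spdA k0 rk rE pE psiE gammaE sigma0 beta1 theta0 ell0 recE v alphaL betaL.
have inv j (jk : (j <= k)%N) := dpbcg_inv spdA rk jk.
(* The value [d (k + 1)] is arbitrary here; [dk] replaces it by the last pivot of [T_(k+1)]. *)
pose dk : nat -> 'M[R]_m := fun j =>
  if j == k.+1 then alphaL k.+1 - ell k *m d k *m (ell k)^T else d j.
have dkE j : (j <= k)%N -> dk j = d j by move=> jk; rewrite /dk ltn_eqF.
have ldl := rec_ldl spdA rk rE pE psiE gammaE sigma0 beta1 theta0 ell0 recE.
have ldlk K : (K <= k.+1)%N -> is_block_ldl (block_tridiag K alphaL betaL) ell dk.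
  move=> Kk; apply: ldl => // [j /andP[_ /dkE] //|_].
  by rewrite /dk eqxx.
have ud j : (1 <= j <= k)%N -> d j \in unitmx.
  case: j => // j jk; apply: spdmx_unit.
  exact: (rec_d_spd spdA rk rE pE psiE gammaE sigma0 theta0 recE).
split; [split|split; [|split; [|split; [|split]]]].
- split=> [|[//|j] jk]; first exact: (rec_r0_full spdA rk).
  exact: (lanczos_alphaE spdA rk rE pE psiE gammaE sigma0 beta1 theta0 ell0 recE jk).2.
- split=> [|j jk]; first exact: (rec_r0_full spdA rk).
  have ij := inv j (ltnW jk); split; first exact: spdmx_unit (dp_pAp_spd spdA ij).
  by apply: dp_dir_full => //; rewrite -dp_step_r (dp_inv_full (inv _ jk)).
- by move=> j /ltnW; exact: (rec_gamma_unit spdA rk gammaE).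
- move=> j jk; split; first exact: (rec_sigma_unit spdA rk rE pE psiE sigma0 recE jk).
  exact: (rec_theta_unit spdA rk rE pE psiE gammaE sigma0 theta0 recE jk).
- case=> // j jk; rewrite (rec_psi_p_r spdA rk rE pE psiE) //; split.
    exact: (rec_gram_spd spdA rk rE).
  have [Eb pb] := rec_beta spdA rk rE pE psiE gammaE sigma0 theta0 recE jk.
  rewrite Eb row_full_unit unitmx_mul (upper_posdiag_unit pb) andbT.
  exact: (rec_theta_unit spdA rk rE pE psiE gammaE sigma0 theta0 recE jk).
- case=> // j jk; split; apply/esym.
    exact: (lanczos_alphaE spdA rk rE pE psiE gammaE sigma0 beta1 theta0 ell0 recE jk).1.
  exact: (lanczos_betaE spdA rk rE pE psiE gammaE sigma0 beta1 theta0 ell0 recE).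
- by apply: ldl => // /eqP; rewrite ltn_eqF.
- by exists ell, dk; exact: ldlk.
- move=> K ell' d' /andP[kK Kk] ldl'.
  have udk j : (1 <= j <= k)%N -> dk j \in unitmx.
    by move=> jk; rewrite dkE ?ud //; case/andP: jk.
  have uniq := block_ldl_unique udk (ldlk K Kk) ldl'.
  split=> -[//|j] jK.
    by have [_ ->] := uniq _ jK (leq_trans jK Kk).
  by have [-> _] := uniq j (leq_trans jK kK) (ltnW jK); rewrite dkE.
- exact: (rec_lanczos_v spdA rk rE pE psiE gammaE sigma0 beta1 theta0 ell0 recE).
Qed.
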